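(* Let $\mathcal T_n$ be a directed rooted tree on $n\ge 3$ nodes, either downward directed or upward directed, in which every non-leaf node has at least two children, and let $\chi_{\mathtt t}$ be its tree monitor placement. Then $\mu(\mathcal T_n\mid\chi_{\mathtt t})=1$ under either the $\mathrm{CSP}$ or the $\mathrm{CAP}^-$ routing mechanism.
   Context: A downward directed tree is a rooted tree with all edges directed from parent to child (the root is the only source, the leaves the only sinks); an upward directed tree has all edges directed from child to parent. The monitor placement $\chi_{\mathtt t}=(\mathfrak m,\mathfrak M)$ is: for a downward tree, $\mathfrak m=\{\text{root}\}$ and $\mathfrak M=$ the set of leaves; for an upward tree, $\mathfrak m=$ the set of leaves and $\mathfrak M=\{\text{root}\}$. The set of measurement paths $\mathbb P(G\mid\chi)$ (directed paths, following edge directions) depends on the routing mechanism: under $\mathrm{CSP}$ it consists of all simple directed paths from a node of $\mathfrak m$ to a different node of $\mathfrak M$; under $\mathrm{CAP}^-$ it consists of all directed walks starting at a node of $\mathfrak m$ and ending at a node of $\mathfrak M$, except single-node paths consisting of one node in $\mathfrak m\cap\mathfrak M$. For a node $v$, $\mathbb P(v)$ is the set of measurement paths through $v$, and $\mathbb P(U)=\bigcup_{u\in U}\mathbb P(u)$. $V$ is $k$-identifiable if for all $U,W\subseteq V$ with $U\neq W$ and $|U|,|W|\le k$, $\mathbb P(U)\neq\mathbb P(W)$. $\mu(G\mid\chi)$ is the largest $k\ge0$ such that $V$ is $k$-identifiable with respect to $\mathbb P(G\mid\chi)$. *)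

(* Defs.v *)
From HB Require Import structures.
From mathcomp Require Import all_boot.
From mathcomp Require Import boolp classical_sets.

Set Implicit Arguments.
Unset Strict Implicit.
Unset Printing Implicit Defensive.

(* MathComp world. A digraph is an edge relation [e : rel V] on a finType; a
   walk is identified with its nonempty sequence of nodes. *)

Section Trees.
Variable V : finType.

Definition underlying (e : rel V) : rel V := fun x y => e x y || e y x.

(* An edge of a symmetric [t], traversed back and forth, is a [ucycle] of
   size 2, hence the bound. *)
Definition is_tree (t : rel V) : Prop :=
  [/\ symmetric t, irreflexive t,
      forall x y : V, connect t x y
    & forall c : seq V, ucycle t c -> size c <= 2].

(* [x] is the node preceding [y] on a simple path from the root [r] to [y]. *)
Definition is_parent (t : rel V) (r x y : V) : Prop :=
  exists p : seq V,
    [/\ path t r (rcons p y), uniq (r :: rcons p y) & last r p = x].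

Inductive direction := Downward | Upward.

Definition parent_child (d : direction) (e : rel V) : rel V :=
  match d with
  | Downward => fun x y => e x y
  | Upward => fun x y => e y x
  end.

Definition directed_tree (d : direction) (r : V) (e : rel V) : Prop :=
  is_tree (underlying e) /\
  forall x y : V, parent_child d e x y -> is_parent (underlying e) r x y.

Definition children (d : direction) (e : rel V) (v : V) : {set V} :=
  finset (parent_child d e v).

Definition leaves (d : direction) (e : rel V) : {set V} :=
  finset (fun v => children d e v == finset.set0).

End Trees.

Section Monitoring.
Variable V : finType.

Record placement := Placement { inputs : {set V}; outputs : {set V} }.

Definition tree_placement (d : direction) (r : V) (e : rel V) : placement :=
  match d with
  | Downward => Placement (finset.set1 r) (leaves d e)
  | Upward => Placement (leaves d e) (finset.set1 r)
  end.

Inductive routing := CSP | CAPminus.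

Definition measurement_paths (R : routing) (e : rel V) (chi : placement) :
    set (seq V) :=
  match R with
  | CSP => fun s => exists x p,
      [/\ s = x :: p, path e x p, uniq (x :: p)
        & [/\ x \in inputs chi, last x p \in outputs chi & x <> last x p]]
  | CAPminus => fun s => exists x p,
      [/\ s = x :: p, path e x p, x \in inputs chi, last x p \in outputs chi
        & ~ exists2 v, v \in inputs chi :&: outputs chi & s = [:: v]]
  end.

Definition through (P : set (seq V)) (v : V) : set (seq V) :=
  fun s => P s /\ v \in s.

Definition through_set (P : set (seq V)) (U : {set V}) : set (seq V) :=
  (\bigcup_(u in [set` U]) through P u)%classic.

Definition identifiable (P : set (seq V)) (k : nat) : Prop :=
  forall U W : {set V}, U <> W -> #|U| <= k -> #|W| <= k ->
    through_set P U <> through_set P W.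

(* A predicate on [k] rather than a function: if all node sets are
   distinguished, every [k] is admissible and there is no largest one. *)
Definition is_max_identifiability (e : rel V) (R : routing) (chi : placement)
    (k : nat) : Prop :=
  identifiable (measurement_paths R e chi) k /\
  forall j, identifiable (measurement_paths R e chi) j -> j <= k.

End Monitoring.

(* Main.v *)
(* A measurement path runs along a root-leaf path of the tree, in one direction
   or the other. All of them meet the root r, so {r} and {r, x} are never
   distinguished and mu <= 1. For mu >= 1, the unique simple path from r to a
   node u can be prolonged to a leaf while avoiding any given node v not yet on
   it, since each inner node has a child other than v. Of two distinct nodes,
   one is not an ancestor of the other, so some root-leaf path separates them. *)
Require Import Defs.
From mathcomp Require Import all_boot.
From mathcomp Require classical_sets.

Set Implicit Arguments.
Unset Strict Implicit.
Unset Printing Implicit Defensive.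

Lemma tree_simple_path_unique (V : finType) (t : rel V) (x : V) (p q : seq V) :
  is_tree t -> path t x p -> path t x q -> uniq (x :: p) -> uniq (x :: q) ->
  last x p = last x q -> p = q.
Proof.
case=> t_sym _ _ acyclic.
elim: p x q => [|a p IHp] x [|b q] //=.
- by move=> _ _ _ /andP[xq _] xE; move: (mem_last b q); rewrite -xE (negPf xq).
- by move=> _ _ /andP[xp _] _ xE; move: (mem_last a p); rewrite xE (negPf xp).
move=> /andP[txa pa] /andP[txb pb] /andP[xp Up] /andP[xq Uq] lastE.
have [ab|ab] := eqVneq a b.
  by rewrite -ab in pb Uq lastE *; rewrite (IHp a q).
(* The two branches are joined without passing through x; closing up at x gives
   a simple cycle of length at least 3. *)
pose t' := [rel y z | [&& t y z, y != x & z != x]].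
have t'_sym : symmetric t' by move=> y z /=; rewrite t_sym [(z != x) && _]andbC.
have t'_path y s : path t y s -> x \notin y :: s -> path t' y s.
  elim: s y => //= z s IHs y /andP[tyz pz].
  rewrite in_cons negb_or => /andP[xy xz].
  rewrite tyz eq_sym xy IHs // eq_sym.
  by move: xz; rewrite in_cons negb_or => /andP[->].
have /connectP[s sP sE] : connect t' a b.
  apply: (@connect_trans _ _ (last a p)).
    by apply/connectP; exists p => //; apply: t'_path.
  rewrite lastE (sym_connect_sym t'_sym).
  by apply/connectP; exists q => //; apply: t'_path.
case/shortenP: sP sE => s' s'P Us' _ bE.
have s'_t : path t a s' by apply: sub_path s'P => y z /and3P[].
have ax : x != a by apply: contraNneq xp => ->; rewrite mem_head.
have xs' : x \notin s'.
  elim: s' (a) s'P {Us' bE s'_t} => //= z s' IHs y /andP[/and3P[_ _ zx] ps'].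
  by rewrite in_cons negb_or eq_sym zx (IHs z).
have /acyclic : ucycle t (x :: a :: s').
  rewrite /ucycle /= rcons_path txa s'_t -bE t_sym txb /=.
  by rewrite in_cons negb_or ax xs'.
(* The size bound forces [s'] to be empty, so that [b = a]. *)
by case: s' bE {s'P Us' s'_t xs'} => //= bE; rewrite bE eqxx in ab.
Qed.

Lemma exists_neq (V : finType) (r : V) : 1 < #|V| -> exists v, v != r.
Proof.
move=> /card_gt1P[x [y [_ _ xy]]].
by have [xr|] := eqVneq x r; [exists y; rewrite -xr eq_sym | exists x].
Qed.

Section RootPaths.

Variables (V : finType) (d : direction) (r : V) (e : rel V).
Hypothesis tree_e : directed_tree d r e.

Let t := underlying e.
Let c := parent_child d e.

Let tree_t : is_tree t. Proof. by case: tree_e. Qed.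

Let c_t x y : c x y -> t x y.
Proof. by rewrite /c /t /underlying; case: d => /= ->; rewrite ?orbT. Qed.

Let t_c x y : t x y -> c x y || c y x.
Proof. by rewrite /c /t /underlying; case: d => //=; rewrite orbC. Qed.

(** If the last edge went up, [y] would be the parent of [last r p]. The simple path from [r]
    through [y] to [last r p] is [p] itself, so [y] would already lie on it. *)
Lemma simple_path_descends (p : seq V) :
  path t r p -> uniq (r :: p) -> path c r p.
Proof.
elim/last_ind: p => // p y IHp; rewrite !rcons_path => /andP[tp ty].
rewrite -rcons_cons rcons_uniq => /andP[yp Up]; rewrite IHp //=.
case/orP: (t_c ty) => // /(proj2 tree_e)[q [tq Uq qE]].
have pE : rcons q (last r p) = p.
  by apply: (tree_simple_path_unique tree_t tq) => //; rewrite last_rcons.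
by move: yp; rewrite -pE -rcons_cons mem_rcons in_cons -qE mem_last orbT.
Qed.

(** The last edge comes with a simple path from [r] that ends in it; by uniqueness its initial part
    is [p]. *)
Lemma root_path_uniq (p : seq V) : path c r p -> uniq (r :: p).
Proof.
elim/last_ind: p => // p y IHp; rewrite rcons_path => /andP[cp cy].
have [q [tq Uq qE]] := (proj2 tree_e) _ _ cy.
suff <- : q = p by [].
apply: (tree_simple_path_unique tree_t) qE.
- by move: tq; rewrite rcons_path => /andP[].
- by apply: sub_path cp => x z /c_t.
- by move: Uq; rewrite -rcons_cons rcons_uniq => /andP[].
- exact: IHp.
Qed.

Lemma root_path_exists (v : V) : exists2 p, path c r p & v = last r p.
Proof.
have [_ _ /(_ r v)/connectP[p0 tp0 vE] _] := tree_t.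
case/shortenP: tp0 vE => p tp Up _ vE.
by exists p => //; apply: simple_path_descends.
Qed.

Lemma root_not_leaf : 1 < #|V| -> r \notin leaves d e.
Proof.
move=> /(exists_neq r)[v vr].
have [[|a p] /= cp vE] := root_path_exists v; first by rewrite vE eqxx in vr.
rewrite inE; apply/set0Pn; exists a; rewrite inE.
by case/andP: cp.
Qed.

Hypothesis branching :
  forall v : V, v \notin leaves d e -> 2 <= #|children d e v|.

Lemma avoiding_leaf_extension (A : {set V}) (p : seq V) :
  #|A| <= 1 -> path c r p -> [disjoint r :: p & A] ->
  exists q, [/\ path c r (p ++ q), last r (p ++ q) \in leaves d e
              & [disjoint r :: p ++ q & A]].
Proof.
(* Greedy descent outside [A]; it stops because paths of child edges from [r] are simple, hence
   shorter than [#|V|]. *)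
move=> A1; have [m] := ubnP (#|V| - size p).
elim: m p => // m IHm p lt_m cp dA.
have [leaf_p|/branching deg2] := boolP (last r p \in leaves d e).
  by exists [::]; rewrite cats0.
have /subsetPn[y] : ~~ (children d e (last r p) \subset A).
  by apply: contraTN deg2 => /subset_leq_card/leq_trans/(_ A1); rewrite -ltnNge.
rewrite inE => cy yA.
have cpy : path c r (rcons p y) by rewrite rcons_path cp.
have size_p : size p < #|V|.
  by have := max_card (mem (r :: p)); rewrite (card_uniqP (root_path_uniq cp)).
have [|//||q] := IHm (rcons p y).
- by rewrite size_rcons subnS -ltnS prednK ?subn_gt0.
- by rewrite -rcons_cons -cats1 disjoint_cat dA disjoint_has /= orbF.
by rewrite -cats1 -catA => qP; exists (y :: q).
Qed.

(** Only [=i] is claimed because in an upward tree the measurement path is the reversal of [r :: p].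
    As [r] is not a leaf, the two ends differ, which meets the side conditions of both routing
    mechanisms. *)
Lemma root_leaf_path_measured (R : routing) (p : seq V) :
  1 < #|V| -> path c r p -> last r p \in leaves d e ->
  exists2 s, measurement_paths R e (tree_placement d r e) s & s =i r :: p.
Proof.
move=> V1 cp leaf_p; have rL := root_not_leaf V1.
have Up := root_path_uniq cp.
have rp : r <> last r p by move=> rE; rewrite rE leaf_p in rL.
move: (cp) (leaf_p) (rL); rewrite /c; case: (d) => /= cp' leaf_p' rL'.
  exists (r :: p) => //; case: R; exists r, p; split => //=.
  - by rewrite inE.
  - by rewrite inE.
  - by case=> v /setIP[/set1P-> vL]; rewrite vL in rL'.
have revE : last r p :: rev (belast r p) = rev (r :: p).
  by rewrite [in RHS]lastI rev_rcons.
have lastE : last (last r p) (rev (belast r p)) = r.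
  by case: (p) => //= a q; rewrite rev_cons last_rcons.
have ep : path e (last r p) (rev (belast r p)) by rewrite rev_path.
exists (rev (r :: p)); last by move=> x; rewrite mem_rev.
rewrite -revE; case: R; exists (last r p), (rev (belast r p)); split => //=.
- by rewrite -[_ && _]/(uniq (_ :: _)) revE rev_uniq.
- by rewrite lastE inE; split => //; apply: nesym.
- by rewrite lastE inE.
- by case=> v /setIP[vL /set1P vr]; rewrite -vr vL in rL'.
Qed.

Lemma measurement_path_root (R : routing) (s : seq V) :
  measurement_paths R e (tree_placement d r e) s -> r \in s.
Proof.
case: R; case=> x [p]; case: (d) => /=.
- by case=> -> _ _ [/set1P-> _ _]; rewrite mem_head.
- by case=> -> _ _ [_ /set1P<- _]; rewrite mem_last.
- by case=> -> _ /set1P-> _ _; rewrite mem_head.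
- by case=> -> _ _ /set1P<- _; rewrite mem_last.
Qed.

(** Prolonged to a leaf outside [W], the path [p] gives a measurement path that meets [U] but not
    [W]. *)
Lemma through_set_separated (R : routing) (U W : {set V}) (p : seq V) :
  1 < #|V| -> #|W| <= 1 -> path c r p -> last r p \in U ->
  [disjoint r :: p & W] ->
  through_set (measurement_paths R e (tree_placement d r e)) U <>
  through_set (measurement_paths R e (tree_placement d r e)) W.
Proof.
move=> V1 W1 cp pU dW eqUW.
have [q [cq leaf_q dqW]] := avoiding_leaf_extension W1 cp dW.
have [s sP sE] := root_leaf_path_measured R V1 cq leaf_q.
have : through_set (measurement_paths R e (tree_placement d r e)) U s.
  exists (last r p) => //; split => //.
  by rewrite sE -cat_cons mem_cat mem_last.
rewrite eqUW => -[w wW [_]]; rewrite sE => ws.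
by have := disjointFr dqW ws; rewrite wW.
Qed.

Lemma tree_identifiable1 (R : routing) :
  1 < #|V| -> identifiable (measurement_paths R e (tree_placement d r e)) 1.
Proof.
move=> V1 U W /eqP; rewrite eqEsubset negb_and.
wlog UW : U W / ~~ (U \subset W).
  move=> WLOG /orP[UW|WU] U1 W1; first by apply: WLOG => //; rewrite UW.
  by apply: nesym; apply: WLOG => //; rewrite WU.
case/subsetPn: UW => u uU uW _ U1 W1.
have [p cp uE] := root_path_exists u.
have [dW|] := boolP [disjoint r :: p & W].
  by apply: (through_set_separated V1 W1 cp) dW; rewrite -uE.
(* The node of W is a proper ancestor of u, so the path to it avoids U. *)
rewrite disjoint_has negbK => /hasP[v vp vW].
case/splitPl: vp cp uE => p1 p2 p1E cp uE.
have cp1 : path c r p1 by move: cp; rewrite cat_path => /andP[].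
apply: nesym; apply: (through_set_separated V1 U1 cp1); first by rewrite p1E.
rewrite disjoint_has; apply/hasPn => x xp1; apply: contraL xp1.
(* Here [U] is the singleton of [u], so it remains to keep [u] off [r :: p1]. It is the end of [p2],
   which is nonempty since otherwise [u = v] would lie in [W]. *)
move=> /(card_le1_eqP U1 _ _ uU) ->.
have := root_path_uniq cp; rewrite -cat_cons cat_uniq => /and3P[_ /hasPn dis _].
apply: dis; case: p2 uE {cp} => [|b p2]; last
  by rewrite last_cat /= => ->; rewrite mem_last.
by rewrite cats0 p1E => uv; rewrite uv vW in uW.
Qed.

Lemma tree_not_identifiable2 (R : routing) (j : nat) :
  1 < #|V| -> 1 < j ->
  ~ identifiable (measurement_paths R e (tree_placement d r e)) j.
Proof.
move=> /(exists_neq r)[v vr] j2 idj.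
apply: (idj [set r] [set r; v]).
- by move=> /setP/(_ v); rewrite !inE eqxx orbT (negPf vr).
- by rewrite cards1 ltnW.
- by rewrite cards2 (leq_trans _ j2) // ltnS leq_b1.
(* Both sides consist of all measurement paths, with [r] as the common witness. *)
apply/classical_sets.seteqP; split => s [w _ [sP _]];
  exists r => /=; rewrite ?inE ?eqxx //; split => //;
  exact: measurement_path_root sP.
Qed.

End RootPaths.

Theorem theorem2 (n : nat) (V : finType) (e : rel V) (r : V)
    (d : direction) (R : routing) :
  #|V| = n -> 3 <= n ->
  directed_tree d r e ->
  (forall v : V, v \notin leaves d e -> 2 <= #|children d e v|) ->
  is_max_identifiability e R (tree_placement d r e) 1.
Proof.
move=> <- /ltnW V1 tree_e branching; split; first exact: tree_identifiable1.
move=> j idj; rewrite leqNgt; apply/negP => j2.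
exact: (tree_not_identifiable2 V1 j2 idj).
Qed.
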